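(* Let $S$ be a finite semigroup with zero $0$ and radical $R(S)$, and let $\mathcal{M}$ be a non-empty set of minimal idempotents of the Rees quotient $\bar S=S/R(S)$ such that (1) the elements of $\mathcal{M}$ commute pairwise; (2) for every $0\neq x\in \bar S$ there exist $e,f\in\mathcal{M}$ such that $exf\neq 0$; (3) for all $x,y\in\bar S$ and all $e,f\in\mathcal{M}$ one has $\{exgyf: g\in\mathcal{M}\}\subset\{0,exyf\}$, and moreover $\{exgyf:g\in\mathcal{M}\}\neq\{0\}$ if $exyf\neq 0$. Let $\mathcal{M}=\mathcal{M}_1\cup\dots\cup\mathcal{M}_k$ be the decomposition of $\mathcal{M}$ into the disjoint union of equivalence classes with respect to the restriction to $\mathcal{M}$ of Green's relation $\mathcal{D}$ of $\bar S$. Then there is a bijection between the set of maximal nilpotent subsemigroups of $S$ and the set of collections $(\rho_1,\dots,\rho_k)$, where $\rho_i$ is a linear order on $\mathcal{M}_i$ for $i=1,\dots,k$.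
   Context: A semigroup $T$ with zero $0$ is nilpotent if $T^m=\{0\}$ for some $m\in\mathbb{N}$; a nilpotent subsemigroup of $S$ is a subsemigroup $T\subset S$ with $T^m=\{0\}$ for some $m$, where $0$ is the zero of $S$. A maximal nilpotent subsemigroup of $S$ is a maximal element, with respect to inclusion, of the set of all nilpotent subsemigroups of $S$. $S^1$ is $S$ if $S$ has an identity and $S$ with an identity adjoined otherwise; $(a)=S^1aS^1$ is the principal two-sided ideal generated by $a$. The radical is $R(S)=\{x\in S:(x)\text{ is a nilpotent semigroup}\}$, a two-sided ideal; $S/R(S)$ is the Rees quotient (its radical is $\{0\}$). In a finite semigroup Green's relations $\mathcal{D}$ and $\mathcal{J}$ coincide, and the $\mathcal{D}$-classes are partially ordered by $\mathcal{D}_a\leq\mathcal{D}_b\Leftrightarrow (a)\subset(b)$. A non-zero $\mathcal{D}$-class $D$ is minimal if $D'\leq D$ implies $D'=D$ or $D'=\{0\}$. An idempotent of a finite semigroup with zero $T$ is minimal if it is contained in a minimal $\mathcal{D}$-class of $T/R(T)$; for $T=\bar S$ this simply means that it lies in a minimal $\mathcal{D}$-class of $\bar S$. Linear orders are strict. *)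

(* Defs.v *)
From HB Require Import structures.
From mathcomp Require Import boolp classical_sets functions.
From mathcomp Require Import all_boot.

Set Implicit Arguments.
Unset Strict Implicit.
Unset Printing Implicit Defensive.

Local Open Scope group_scope.

HB.mixin Record Semigroup_hasZero S of Semigroup S := {
  szero : S;
  mul0s : left_zero szero (@mul S);
  muls0 : right_zero szero (@mul S)
}.

#[short(type="finSemigroup0Type")]
HB.structure Definition FinSemigroup0 :=
  {S of Semigroup_hasZero S & Semigroup S & Finite S}.

Bind Scope group_scope with FinSemigroup0.sort.

Notation "0" := (@szero _) : group_scope.

Section FiniteSemigroups.

Variable S : finSemigroup0Type.
Implicit Types (a b c e x y : S) (A B C D N : {set S}).

(* An element of S^1 is [Some x] with x in S, or [None], which stands for the
   adjoined identity and belongs to S^1 only if S has no identity of its own. *)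

Definition has_identity := [exists e : S, forall x : S, (e * x == x) && (x * e == x)].

Definition S1 : {set option S} :=
  if has_identity then [set Some x | x in [set: S]] else [set: option S].

Definition mul1l (u : option S) x := if u is Some a then a * x else x.
Definition mul1r x (u : option S) := if u is Some a then x * a else x.

Definition left_ideal a := [set mul1l u a | u in S1].
Definition right_ideal a := [set mul1r a u | u in S1].
Definition principal_ideal a := [set mul1r (mul1l u a) v | u in S1, v in S1].

Definition greenL a b := left_ideal a == left_ideal b.
Definition greenR a b := right_ideal a == right_ideal b.
Definition greenD a b := [exists c, greenL a c && greenR c b].

Definition Dclass a := [set b | greenD a b].
Definition is_Dclass D := exists a, D = Dclass a.
Definition Dclass_le D1 D2 :=
  exists a b, [/\ D1 = Dclass a, D2 = Dclass b
                & principal_ideal a \subset principal_ideal b].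

Definition minimal_Dclass D :=
  [/\ is_Dclass D, D <> [set 0]
    & forall D', is_Dclass D' -> Dclass_le D' D -> D' = D \/ D' = [set 0]].

(* Meant for semigroups with zero radical, such as S / R(S); in general one has
   to pass to the quotient by the radical first. *)
Definition minimal_idempotent e :=
  e * e = e /\ exists2 D, minimal_Dclass D & e \in D.

Definition set_mul A B := [set x * y | x in A, y in B].

(* [set_expS A n] is A^(n+1), so that the exponent m in A^m = {0} is positive. *)
Definition set_expS A n := iter n (set_mul A) A.

Definition nilpotent A := exists n, set_expS A n = [set 0].

Definition nilpotent_subsemigroup N :=
  {in N &, forall x y, x * y \in N} /\ nilpotent N.

Definition maximal_nilpotent_subsemigroup N :=
  nilpotent_subsemigroup N /\
  forall N', nilpotent_subsemigroup N' -> N \subset N' -> N' = N.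

Record ideal := Ideal {
  ideal_set :> {set S};
  ideal0 : 0 \in ideal_set;
  idealMl : forall x y, y \in ideal_set -> x * y \in ideal_set;
  idealMr : forall x y, x \in ideal_set -> x * y \in ideal_set
}.

Definition radical_set : {set S} :=
  [set x | `[< nilpotent (principal_ideal x) >]].

Lemma principal_ideal0 : principal_ideal 0 = [set 0].
Proof.
apply/setP=> z; rewrite inE; apply/imset2P/eqP => [[u v _ _ ->]|->].
  by case: u v => [u|] [v|]; rewrite /= ?muls0 ?mul0s.
have S1in : exists u : option S, u \in S1.
  rewrite /S1; case: ifP => _; last by exists None; rewrite inE.
  by exists (Some 0); apply/imsetP; exists 0; rewrite ?inE.
case: S1in => u uS; exists u u => //.
by case: u uS => [u|] _ /=; rewrite ?muls0 ?mul0s.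
Qed.

Lemma in_S1 u : (u \in S1) = (u != None) || ~~ has_identity.
Proof.
rewrite /S1; case: ifP => [_|_]; last by rewrite inE orbT.
rewrite orbF; apply/imsetP/idP => [[x _ ->] //|].
by case: u => // x _; exists x; rewrite ?inE.
Qed.

Lemma in_S1_Some x : Some x \in S1.
Proof. by rewrite in_S1. Qed.

Lemma principal_idealMl x y : principal_ideal (x * y) \subset principal_ideal y.
Proof.
apply/subsetP => z /imset2P[u v uS vS ->].
apply/imset2P; exists (Some (mul1l u x)) v => //; first exact: in_S1_Some.
by case: u v uS vS => [u|] [v|] _ _ /=; rewrite ?mulgA.
Qed.

Lemma principal_idealMr x y : principal_ideal (x * y) \subset principal_ideal x.
Proof.
apply/subsetP => z /imset2P[u v uS vS ->].
apply/imset2P; exists u (Some (mul1r y v)) => //; first exact: in_S1_Some.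
by case: u v uS vS => [u|] [v|] _ _ /=; rewrite ?mulgA.
Qed.

Lemma principal_ideal_has0 x : 0 \in principal_ideal x.
Proof.
apply/imset2P; exists (Some 0) (Some 0); rewrite ?in_S1_Some //=.
by rewrite muls0.
Qed.

Lemma set_mulSS A B C D :
  A \subset C -> B \subset D -> set_mul A B \subset set_mul C D.
Proof. by move=> AC BD; apply: imset2S. Qed.

Lemma set_expSS A B n : A \subset B -> set_expS A n \subset set_expS B n.
Proof. by move=> AB; elim: n => //= n IHn; apply: set_mulSS. Qed.

Lemma set_expS_has0 A n : 0 \in A -> 0 \in set_expS A n.
Proof.
move=> A0; elim: n => //= n IHn.
by apply/imset2P; exists 0 0 => //; rewrite mul0s.
Qed.

Lemma nilpotentS A B : 0 \in A -> A \subset B -> nilpotent B -> nilpotent A.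
Proof.
move=> A0 AB [n Bn]; exists n; apply/eqP.
by rewrite eqEsubset -{1}Bn set_expSS //= sub1set set_expS_has0.
Qed.

Lemma radicalP x :
  reflect (nilpotent (principal_ideal x)) (x \in radical_set).
Proof. by rewrite inE; exact: asboolP. Qed.

Lemma radical0 : 0 \in radical_set.
Proof. by apply/radicalP; exists 0%N; exact: principal_ideal0. Qed.

Lemma radicalMl x y : y \in radical_set -> x * y \in radical_set.
Proof.
move=> /radicalP Ry; apply/radicalP.
exact: (nilpotentS (principal_ideal_has0 _) (principal_idealMl x y) Ry).
Qed.

Lemma radicalMr x y : x \in radical_set -> x * y \in radical_set.
Proof.
move=> /radicalP Rx; apply/radicalP.
exact: (nilpotentS (principal_ideal_has0 _) (principal_idealMr x y) Rx).
Qed.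

Definition radical : ideal := Ideal radical0 radicalMl radicalMr.

(* Since I contains 0, the Rees quotient S / I = (S \ I) u {I} is carried by
   (S \ I) u {0}, where 0 represents the class I. *)
Record rees_quotient (I : ideal) := ReesQuotient {
  rees_val : S;
  _ : (rees_val == 0) || (rees_val \notin I)
}.

End FiniteSemigroups.

Section ReesQuotient.

Variables (S : finSemigroup0Type) (I : ideal S).

Notation Q := (rees_quotient I).

HB.instance Definition _ := [isSub for @rees_val S I].
HB.instance Definition _ := [Finite of Q by <:].

Definition rees_repr (x : S) : S := if x \in I then 0 else x.

Fact rees_repr_subproof x : (rees_repr x == 0) || (rees_repr x \notin I).
Proof. by rewrite /rees_repr; case: ifP => [_|->]; rewrite ?eqxx ?orbT. Qed.

Definition rees_proj (x : S) : Q := ReesQuotient (rees_repr_subproof x).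

Definition rees_mul (p q : Q) : Q := rees_proj (val p * val q).
Definition rees_zero : Q := rees_proj 0.

Fact rees_mulA : associative rees_mul.
Proof.
move=> p q r; apply: val_inj; rewrite /= /rees_repr.
have [qrI|qrI] := boolP (val q * val r \in I);
  have [pqI|pqI] := boolP (val p * val q \in I);
  rewrite ?muls0 ?mul0s ?mulgA ?ideal0 //.
- by rewrite -mulgA idealMl.
- by rewrite idealMr.
Qed.

HB.instance Definition _ := isSemigroup.Build Q rees_mulA.

Fact rees_mul0s : left_zero rees_zero (@mul Q).
Proof.
by move=> p; apply: val_inj; rewrite /= /rees_repr ideal0 mul0s ideal0.
Qed.

Fact rees_muls0 : right_zero rees_zero (@mul Q).
Proof.
by move=> p; apply: val_inj; rewrite /= /rees_repr ideal0 muls0 ideal0.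
Qed.

HB.instance Definition _ := Semigroup_hasZero.Build Q rees_mul0s rees_muls0.

End ReesQuotient.

(* A relation on A is given by its graph r, a subset of A x A. *)
Definition strict_linear_order (T : finType) (A : {set T}) (r : {set T * T}) :=
  [/\ r \subset setX A A,
      forall x, (x, x) \notin r,
      forall x y z, (x, y) \in r -> (y, z) \in r -> (x, z) \in r
    & {in A &, forall x y, x != y -> ((x, y) \in r) || ((y, x) \in r)}].

(* Main.v *)
(* Write px for the image of x in S / R(S), and let the support of x be the
   relation {(e, f) | e * px * f <> 0} on M.  By minimality of the idempotents,
   supports stay inside the blocks M_i and e * px * g <> 0, g * py * f <> 0 imply
   e * px * g * py * f <> 0; with hypothesis (3) this makes the support
   multiplicative (a product goes to the composite relation).  By (2), only
   elements of the radical have empty support.  The commuting idempotents of M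
   are pairwise orthogonal, so each pair in M_i x M_i is by itself the support of
   some element.  The union of the supports of a nilpotent subsemigroup is thus a
   strict partial order, which extends to linear orders on the blocks; conversely
   the elements supported in given linear orders form a subsemigroup of nilpotent
   elements, which is nilpotent by finiteness. *)
Require Import Defs.
From mathcomp Require Import boolp classical_sets functions.
From mathcomp Require Import all_boot.
From mathcomp Require Import zify.

Set Implicit Arguments.
Unset Strict Implicit.
Unset Printing Implicit Defensive.

Local Open Scope group_scope.

(** * Finite combinatorics: pigeonhole, linear extensions, commuting maps *)

Lemma nat_pigeonhole (T : finType) (f : nat -> T) :
  exists i j, [/\ (i < j)%N, (j <= #|T|)%N & f i = f j].
Proof.
have /injectiveP/injectivePn : ~ injective (fun i : 'I_#|T|.+1 => f i).
  by move=> /leq_card; rewrite card_ord ltnn.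
case=> i [j nij eqf].
wlog ltij : i j nij eqf / (i < j)%N.
  move=> IH; have [ltij|ltji|/val_inj eqij] := ltngtP i j; first exact: IH eqf ltij.
    by apply: (IH j i) => //; rewrite eq_sym.
  by rewrite eqij eqxx in nij.
by exists i, j; split=> //; rewrite -ltnS.
Qed.

(* Order first by the number of predecessors, then by an arbitrary enumeration. *)
Lemma linear_extension (T : finType) (r : rel T) :
    irreflexive r -> transitive r ->
  exists s : rel T, [/\ irreflexive s, transitive s,
    (forall x y, x != y -> s x y || s y x) & subrel r s].
Proof.
move=> r_irr r_tr.
pose c x := #|[set z | r z x]|.
exists (fun x y => (c x < c y)%N || (c x == c y) && (enum_rank x < enum_rank y)%N).
split=> [x|y x z|x y nxy|x y rxy]; try lia.
  have : enum_rank x <> enum_rank y :> nat.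
    by move/val_inj/enum_rank_inj/eqP; rewrite (negPf nxy).
  lia.
apply/orP; left; apply: proper_card; apply/properP; split.
  by apply/subsetP=> z; rewrite !inE => /r_tr; apply.
by exists x; rewrite inE ?r_irr.
Qed.

(** Since G^n F^n x = x for all n, applying G^i to a coincidence F^i x = F^j x cancels i copies of
    F. With a left and a right multiplication as F and G, this yields the stability of finite
    semigroups. *)
Lemma iter_fixed (T : finType) (F G : T -> T) x :
    (forall y, F (G y) = G (F y)) -> F (G x) = x ->
  exists n, iter n.+1 F x = x.
Proof.
move=> FG FGx.
have GF n y : G (iter n F y) = iter n F (G y) by elim: n => //= n <-.
have GnF m n y : iter m G (iter n F y) = iter n F (iter m G y).
  by elim: m => //= m ->.
have GnFn n : iter n G (iter n F x) = x.
  by elim: n => // n IHn; rewrite iterSr /= -FG GF -iterS iterSr FGx.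
have [i [j [ltij _ eqij]]] := nat_pigeonhole (fun n => iter n F x).
exists (j - i).-1; rewrite prednK ?subn_gt0 // -{1}(GnFn i) -GnF -iterD.
by rewrite subnK 1?ltnW // -eqij GnFn.
Qed.

(** * Powers and nilpotency in a finite semigroup *)

Section Nilpotency.

Variable S : finSemigroup0Type.
Implicit Types (x y z : S) (N : {set S}).

(* [spow x n] is x^(n+1). *)
Definition spow x n := iter n (mul x) x.

Lemma spowD x n m : spow x n * spow x m = spow x (n + m).+1.
Proof. by elim: n => //= n IHn; rewrite -mulgA IHn. Qed.

Lemma spow_spow x n m : exists l, spow (spow x n) m = spow x l.
Proof.
elim: m => [|m [l IHm]]; first by exists n.
by exists (n + l).+1; rewrite -spowD -IHm.
Qed.

Lemma set_expS_spow N n x : x \in N -> spow x n \in set_expS N n.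
Proof. by move=> Nx; elim: n => //= n IHn; apply: imset2_f. Qed.

(** Here [p i] is the product of the last i+1 factors of y; z collects the factors in between, and
    closure of N keeps it in N. *)
Lemma set_expS_chain N n y : {in N &, forall x y, x * y \in N} ->
    y \in set_expS N n ->
  exists2 p : nat -> S, p n = y &
    forall i j, (i < j <= n)%N -> exists2 z, z \in N & p j = z * p i.
Proof.
move=> NM; elim: n y => [|n IHn] y /=.
  by move=> _; exists (fun=> y) => // i j; lia.
case/imset2P=> x y' Nx /IHn[p py' pP] ->.
exists (fun i => if i == n.+1 then x * y' else p i) => [|i j /andP[ltij lejn]].
  by rewrite eqxx.
have -> : (i == n.+1) = false by lia.
case: eqP => [_|jn]; last by apply: pP; lia.
have [->|nin] := eqVneq i n; first by exists x; rewrite ?py'.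
have [|z Nz pn] := pP i n; first by lia.
by exists (x * z); [apply: NM | rewrite -py' pn mulgA].
Qed.

(* Among the #|S|.+1 partial products p_i of a long product two coincide, say
   p_i = p_j = z p_i; as z is nilpotent, p_i = 0. *)
Lemma nil_nilpotent N : 0 \in N -> {in N &, forall x y, x * y \in N} ->
  (forall x, x \in N -> exists n, spow x n = 0) -> nilpotent N.
Proof.
move=> N0 NM Nnil; exists #|S|; apply/eqP.
rewrite eqEsubset sub1set set_expS_has0 // andbT; apply/subsetP => y.
case/(set_expS_chain NM)=> p py pP; rewrite inE -py.
have [i [j [ltij lejS eqp]]] := nat_pigeonhole p.
have [|z /Nnil[n zn] pj] := pP i j; first by rewrite ltij.
have pi0 : p i = 0.
  rewrite -(mul0s (p i)) -zn; elim: n {zn} => [|n IHn] /=; first by rewrite -pj.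
  by rewrite -mulgA -IHn -pj.
have [|w _ ->] := pP i #|S|; first by rewrite (leq_trans ltij lejS) leqnn.
by rewrite pi0 muls0.
Qed.

End Nilpotency.

(** * Green's relations, stability and minimal idempotents *)

Section MinimalIdempotents.

Variable Q : finSemigroup0Type.
Implicit Types a b c e f g p q w x y : Q.

Lemma left_ideal_refl x : x \in left_ideal x.
Proof.
apply/imsetP; have [/existsP[e /forallP /(_ x)/andP[/eqP ex _]]|noid] :=
  boolP (has_identity Q).
  by exists (Some e); rewrite ?in_S1_Some.
by exists None; rewrite ?in_S1.
Qed.

Lemma right_ideal_refl x : x \in right_ideal x.
Proof.
apply/imsetP; have [/existsP[e /forallP /(_ x)/andP[_ /eqP ex]]|noid] :=
  boolP (has_identity Q).
  by exists (Some e); rewrite ?in_S1_Some.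
by exists None; rewrite ?in_S1.
Qed.

Lemma principal_ideal_refl x : x \in principal_ideal x.
Proof.
have /imsetP[u uS ux] := left_ideal_refl x.
have /imsetP[v vS vx] := right_ideal_refl x.
by apply/imset2P; exists u v => //; rewrite -ux.
Qed.

Lemma greenD_refl x : greenD x x.
Proof. by apply/existsP; exists x; rewrite /greenL /greenR !eqxx. Qed.

Lemma greenD_principal a b : greenD a b -> principal_ideal a = principal_ideal b.
Proof.
have subl x y : x \in left_ideal y -> principal_ideal x \subset principal_ideal y.
  by case/imsetP=> [[u|]] _ -> //=; apply: principal_idealMl.
have subr x y : x \in right_ideal y -> principal_ideal x \subset principal_ideal y.
  by case/imsetP=> [[u|]] _ -> //=; apply: principal_idealMr.
case/existsP=> c /andP[/eqP Lac /eqP Rcb].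
transitivity (principal_ideal c); apply/eqP; rewrite eqEsubset.
  by rewrite !subl // -?Lac ?left_ideal_refl // Lac left_ideal_refl.
by rewrite !subr // -?Rcb ?right_ideal_refl // Rcb right_ideal_refl.
Qed.

Lemma greenL_intro a b x y : x = a * y -> y = b * x -> greenL x y.
Proof.
have sub a' x' y' : x' = a' * y' -> left_ideal x' \subset left_ideal y'.
  move=> ->; apply/subsetP=> z /imsetP[u _ ->]; apply/imsetP.
  exists (Some (mul1l u a')); rewrite ?in_S1_Some //.
  by case: u => //= u; rewrite mulgA.
by move=> xy yx; rewrite /greenL eqEsubset (sub _ _ _ xy) (sub _ _ _ yx).
Qed.

Lemma greenR_intro a b x y : x = y * a -> y = x * b -> greenR x y.
Proof.
have sub a' x' y' : x' = y' * a' -> right_ideal x' \subset right_ideal y'.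
  move=> ->; apply/subsetP=> z /imsetP[u _ ->]; apply/imsetP.
  exists (Some (mul1r a' u)); rewrite ?in_S1_Some //.
  by case: u => //= u; rewrite mulgA.
by move=> xy yx; rewrite /greenR eqEsubset (sub _ _ _ xy) (sub _ _ _ yx).
Qed.

Lemma minimal_idempotent_neq0 e : minimal_idempotent e -> e != 0.
Proof.
case=> _ [D [[a Da] Dn0 _] eD]; apply/eqP => e0; apply: Dn0.
have a0 : a = 0.
  have := principal_ideal_refl a; move: eD; rewrite Da inE => /greenD_principal ->.
  by rewrite e0 principal_ideal0 inE => /eqP.
apply/setP => z; rewrite Da a0 !inE; apply/idP/eqP => [|->]; last exact: greenD_refl.
move/greenD_principal; rewrite principal_ideal0 => z0.
by have := principal_ideal_refl z; rewrite -z0 inE => /eqP.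
Qed.

(** The class of y lies below that of e and differs from {0}, so minimality makes the two classes
    equal: (e) is a 0-minimal ideal. *)
Lemma minimal_idempotent_ideal e y : minimal_idempotent e ->
  y \in principal_ideal e -> y != 0 -> e \in principal_ideal y.
Proof.
case=> _ [D [[a Da] _ Dmin] eD] ye yn0.
move: eD; rewrite Da inE => /greenD_principal ae.
have ysub : principal_ideal y \subset principal_ideal e.
  case/imset2P: ye => u v _ _ ->.
  have sub1 : principal_ideal (mul1r (mul1l u e) v) \subset principal_ideal (mul1l u e).
    by case: v => [v|] //=; apply: principal_idealMr.
  by apply: (subset_trans sub1); case: u {sub1} => [u|] //=; apply: principal_idealMl.
have [||Dy|Dy0] := Dmin (Dclass y).
- by exists y.
- by exists y, a; rewrite ae.
- have : y \in Dclass a by rewrite -Da -Dy inE greenD_refl.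
  by rewrite inE => /greenD_principal <-; rewrite ae principal_ideal_refl.
- by have : y \in Dclass y by [rewrite inE greenD_refl]; rewrite Dy0 inE (negPf yn0).
Qed.

Lemma iter_mull n p a b : iter n (mul p) (a * b) = iter n (mul p) a * b.
Proof. by elim: n => //= n ->; rewrite mulgA. Qed.

Lemma iter_mulr n q a b :
  iter n (fun x => x * q) (a * b) = a * iter n (fun x => x * q) b.
Proof. by elim: n => //= n ->; rewrite mulgA. Qed.

(** Write e = e e e and expand the middle factor only: the outer factors absorb a possible adjoined
    identity, so both multipliers lie in the semigroup. *)
Lemma minimal_idempotent_sandwich e y : minimal_idempotent e ->
  y \in principal_ideal e -> y != 0 -> exists u v, e = mul1r e u * y * mul1l v e.
Proof.
move=> emin ye yn0; have ee := emin.1.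
have /imset2P[u v _ _ euv] := minimal_idempotent_ideal emin ye yn0.
exists u, v; rewrite -{1}ee -{1}ee {2}euv.
by case: u v {euv} => [u|] [v|] /=; rewrite ?mulgA.
Qed.

(** Left stability: the sandwich reads e = p e q with p ending in y. Iteration removes q, so e = p^n
    e for some n > 0, and the last p supplies the factor y e. *)
Lemma minimal_idempotent_left e y :
  minimal_idempotent e -> y * e != 0 -> exists w, e = w * (y * e).
Proof.
move=> emin yen0.
have ye : y * e \in principal_ideal e.
  by apply: (subsetP (principal_idealMl y e)); apply: principal_ideal_refl.
have [u [v euv]] := minimal_idempotent_sandwich emin ye yen0.
have epq : mul (mul1r e u * y) (e * mul1l v e) = e.
  by rewrite {4}euv !mulgA.
have [n en] := @iter_fixed _ (mul (mul1r e u * y)) (fun x => x * mul1l v e) e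
   (fun=> mulgA _ _ _) epq.
exists (iter n (mul (mul1r e u * y)) (mul1r e u)).
by rewrite -iter_mull -{1}en iterSr !mulgA.
Qed.

Lemma minimal_idempotent_right e y :
  minimal_idempotent e -> e * y != 0 -> exists w, e = e * y * w.
Proof.
move=> emin eyn0.
have ye : e * y \in principal_ideal e.
  by apply: (subsetP (principal_idealMr e y)); apply: principal_ideal_refl.
have [u [v euv]] := minimal_idempotent_sandwich emin ye eyn0.
have epq : mul (mul1r e u) e * (y * mul1l v e) = e.
  by rewrite {4}euv !mulgA.
have [n en] := @iter_fixed _ (fun x => x * (y * mul1l v e)) (mul (mul1r e u)) e
   (fun=> esym (mulgA _ _ _)) epq.
exists (iter n (fun x => x * (y * mul1l v e)) (mul1l v e)).
by rewrite -iter_mulr -{1}en iterSr !mulgA.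
Qed.

(** If e f were non-zero, then f = w e f and e = w' f e; commuting and idempotency turn these into e
    f = e and f e = f, hence e = f. *)
Lemma minimal_idempotent_commute e f :
  minimal_idempotent e -> minimal_idempotent f -> e * f = f * e ->
  e != f -> e * f = 0.
Proof.
move=> emin fmin efC nef; apply/eqP/negPn/negP => efn0.
have [w fw] := minimal_idempotent_left fmin efn0.
have [|w' ew] := @minimal_idempotent_left e f emin; first by rewrite -efC.
have eef : e * f = e.
  by rewrite {1}ew -!mulgA efC (mulgA f f) fmin.1 -ew.
by case/eqP: nef; rewrite -eef efC {1}fw -!mulgA -efC (mulgA e e) emin.1 -fw.
Qed.

(** Stability gives g = w x g, so g y = w (x g y) would vanish together with x g y. *)
Lemma minimal_idempotent_mul x y g : minimal_idempotent g ->
  x * g != 0 -> g * y != 0 -> x * g * y != 0.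
Proof.
move=> gmin xgn0; have [w gw] := minimal_idempotent_left gmin xgn0.
by rewrite {1}gw -2!mulgA; apply: contraNneq; rewrite mulgA => ->; rewrite muls0.
Qed.

(** The element e x f is itself the intermediate one: L-related to f by left stability, R-related to
    e by right stability. *)
Lemma neq0_greenD e f x : minimal_idempotent e -> minimal_idempotent f ->
  e * x * f != 0 -> greenD f e.
Proof.
move=> emin fmin exfn0; apply/existsP; exists (e * x * f); apply/andP; split.
  have [w fw] := minimal_idempotent_left fmin exfn0.
  exact: greenL_intro fw erefl.
have [|w ew] := @minimal_idempotent_right e (x * f) emin; first by rewrite mulgA.
by apply: (@greenR_intro (x * f) w); rewrite ?mulgA // -[e * x * f]mulgA.
Qed.

(* The witness d completes e L c R f to the square e R d L f of the egg-box. *)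
Lemma greenD_neq0 e f : e * e = e -> f * f = f -> e != 0 -> greenD e f ->
  exists d, e * d * f != 0.
Proof.
move=> ee ff en0 /existsP[c /andP[/eqP Lec /eqP Rcf]].
have [u eu] : exists u, e = u * c.
  have /imsetP[u _ eu] : e \in left_ideal c by rewrite -Lec left_ideal_refl.
  by exists (mul1r e u); rewrite -{1}ee {2}eu; case: u {eu} => [u|] //=; rewrite mulgA.
have [v fv] : exists v, f = c * v.
  have /imsetP[v _ fv] : f \in right_ideal c by rewrite Rcf right_ideal_refl.
  by exists (mul1l v f); rewrite -{1}ff {1}fv; case: v {fv} => [v|] //=; rewrite mulgA.
have fc : f * c = c.
  have /imsetP[w _ ->] : c \in right_ideal f by rewrite -Rcf right_ideal_refl.
  by case: w => [w|] /=; rewrite ?mulgA ff.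
have uf_ev : u * f = e * v by rewrite fv mulgA -eu.
exists (u * f); rewrite uf_ev (mulgA e e) ee -uf_ev -mulgA ff.
by apply: contraNneq en0 => uf0; rewrite eu -fc mulgA uf0 mul0s.
Qed.

End MinimalIdempotents.

(** * Nilpotent subsemigroups and linear orders, for an abstract support map *)

Section OrdersAndNilpotency.

Variables (S : finSemigroup0Type) (T : finType) (M : {set T}).
Variables (supp : S -> rel T) (k : nat) (Mi : 'I_k -> {set T}).
Implicit Types (x y : S) (e f g : T) (N : {set S}).
Implicit Types (rho : {ffun 'I_k -> {set T * T}}).

Hypothesis MiM : forall i e, e \in Mi i -> e \in M.
Hypothesis Mi_cover : forall e, e \in M -> exists i, e \in Mi i.
Hypothesis Mi_disj : forall i j e, e \in Mi i -> e \in Mi j -> i = j.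
Hypothesis supp_Mi : forall x e f i, e \in M -> f \in M ->
  supp x e f -> e \in Mi i -> f \in Mi i.
Hypothesis supp0 : forall e f, ~~ supp 0 e f.
Hypothesis suppM : forall x y e f, e \in M -> f \in M ->
  supp (x * y) e f = [exists g in M, supp x e g && supp y g f].
Hypothesis supp_unit : forall i e f, e \in Mi i -> f \in Mi i ->
  exists x, forall e' f', e' \in M -> f' \in M ->
    supp x e' f' = (e' == e) && (f' == f).
Hypothesis supp_nil : forall x,
  (forall e f, e \in M -> f \in M -> ~~ supp x e f) -> exists n, spow x n = 0.

Definition linear_orders rho := forall i, strict_linear_order (Mi i) (rho i).

Definition semigroup_of_orders rho := [set x |
  [forall e in M, forall f in M, supp x e f ==> [exists i, (e, f) \in rho i]]].

Definition orders_of_semigroup N : {ffun 'I_k -> {set T * T}} :=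
  [ffun i => [set p in setX (Mi i) (Mi i) | [exists x in N, supp x p.1 p.2]]].

Lemma semigroup_of_ordersP rho x :
  reflect (forall e f, e \in M -> f \in M -> supp x e f ->
             exists i, (e, f) \in rho i)
          (x \in semigroup_of_orders rho).
Proof.
rewrite inE; apply: (iffP forall_inP) => [H e f eM fM xef|H e eM].
  by move/forall_inP: (H e eM) => /(_ f fM)/implyP/(_ xef)/existsP.
by apply/forall_inP => f fM; apply/implyP => /(H e f eM fM)/existsP.
Qed.

(** The point g lies in both blocks, and disjointness forces i = j. *)
Lemma linear_orders_trans rho i j e f g : linear_orders rho ->
  (e, g) \in rho i -> (g, f) \in rho j -> (e, f) \in rho i.
Proof.
move=> lin eg gf; have [/subsetP subi _ tri _] := lin i.
have [/subsetP subj _ _ _] := lin j.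
have /setXP[_ gi] := subi _ eg; have /setXP[gj _] := subj _ gf.
by apply: tri eg _; rewrite (Mi_disj gi gj).
Qed.

Lemma semigroup_of_orders_nilpotent rho : linear_orders rho ->
  nilpotent_subsemigroup (semigroup_of_orders rho).
Proof.
move=> lin.
have NM : {in semigroup_of_orders rho &, forall x y,
    x * y \in semigroup_of_orders rho}.
  move=> x y /semigroup_of_ordersP Nx /semigroup_of_ordersP Ny.
  apply/semigroup_of_ordersP => e f eM fM.
  rewrite suppM // => /exists_inP[g gM /andP[/Nx[]// i eg /Ny[]// j gf]].
  by exists i; apply: linear_orders_trans eg gf.
split=> //; apply: nil_nilpotent => //.
  by apply/semigroup_of_ordersP => e f _ _; rewrite (negPf (supp0 _ _)).
move=> x /semigroup_of_ordersP Nx.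
(* The number of predecessors grows strictly along every pair of the support of x, hence by more
   than n along the support of [spow x n]. As it never exceeds #|T|, the support of [spow x #|T|] is
   empty. *)
pose c e := #|[set z | [exists i, (z, e) \in rho i]]|.
have c_lt e f : e \in M -> f \in M -> supp x e f -> (c e < c f)%N.
  move=> eM fM /Nx[]// i ef; apply: proper_card; apply/properP; split.
    apply/subsetP => z; rewrite !inE => /existsP[j ze].
    by apply/existsP; exists j; apply: linear_orders_trans ze ef.
  exists e; rewrite inE; apply/existsP; first by exists i.
  by case=> j; have [_ /(_ e)/negP] := lin j.
have c_spow n e f : e \in M -> f \in M -> supp (spow x n) e f -> (c e + n < c f)%N.
  elim: n e f => [|n IHn] e f eM fM; first by rewrite addn0; apply: c_lt.
  rewrite [spow _ _]/= suppM // => /exists_inP[g gM /andP[/c_lt eg /IHn gf]].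
  by have := eg eM gM; have := gf gM fM; lia.
have [e f eM fM|m xm] := @supp_nil (spow x #|T|).
  apply/negP => /(c_spow _ _ _ eM fM)/leq_trans/(_ (max_card _)); lia.
by have [l xl] := spow_spow x #|T| m; exists l; rewrite -xl.
Qed.

(** No pair of rho is lost: the element whose support is that single pair belongs to the
    semigroup. *)
Lemma semigroup_of_ordersK rho :
  linear_orders rho -> orders_of_semigroup (semigroup_of_orders rho) = rho.
Proof.
move=> lin; apply/ffunP => i; rewrite ffunE; apply/setP => -[e f].
have [/subsetP subi _ _ _] := lin i.
rewrite inE /=; apply/andP/idP => [[/setXP[ei fi]]|ef].
  case/exists_inP => x /semigroup_of_ordersP Nx xef.
  have [|||j ef] := Nx e f; rewrite ?(MiM ei) ?(MiM fi) //.
  have [/subsetP/(_ _ ef)/setXP[ej _] _ _ _] := lin j.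
  by rewrite (Mi_disj ei ej).
have /setXP[ei fi] := subi _ ef; split; first exact: subi.
have [h hP] := supp_unit ei fi; apply/exists_inP; exists h.
  apply/semigroup_of_ordersP => e' f' e'M f'M; rewrite hP //.
  by case/andP => /eqP -> /eqP ->; exists i.
by rewrite hP ?eqxx // (MiM ei, MiM fi).
Qed.

(** Passing to orders gives rho inside rho'. A linear order cannot be properly extended: a new pair
    would be reversed in rho by totality, making a cycle in rho'. *)
Lemma semigroup_of_orders_sub rho rho' : linear_orders rho -> linear_orders rho' ->
  semigroup_of_orders rho \subset semigroup_of_orders rho' -> rho = rho'.
Proof.
move=> lin lin' /subsetP sub.
have incl i p : p \in rho i -> p \in rho' i.
  rewrite -{1}(semigroup_of_ordersK lin) -{1}(semigroup_of_ordersK lin') !ffunE !inE.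
  by case/andP=> -> /exists_inP[x /sub Nx xp]; apply/exists_inP; exists x.
apply/ffunP => i; apply/setP => -[e f]; apply/idP/idP => [/incl //|ef].
have [_ _ _ tot] := lin i; have [/subsetP sub' irr' tr' _] := lin' i.
have /setXP[ei fi] := sub' _ ef.
have nef : e != f by apply: contraTneq ef => ->; apply: irr'.
case/orP: (tot e f ei fi nef) => // /incl fe.
by have := irr' e; rewrite (tr' _ _ _ ef fe).
Qed.

Lemma nilpotent_sub_semigroup_of_orders N : nilpotent_subsemigroup N ->
  exists2 rho, linear_orders rho & N \subset semigroup_of_orders rho.
Proof.
move=> nilN; have [NM [n Nn]] := nilN.
pose r := [rel e f | [&& e \in M, f \in M & [exists x in N, supp x e f]]].
have r_irr : irreflexive r.
  move=> e; apply/and3P => -[eM _ /exists_inP[x Nx xee]].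
  (* A loop at e survives in all powers of x, although [spow x n] is 0. *)
  have : supp (spow x n) e e.
    elim: n {Nn} => // n IHn; rewrite [spow _ _]/= suppM //.
    by apply/exists_inP; exists e; rewrite ?xee.
  by have := set_expS_spow n Nx; rewrite Nn inE => /eqP ->; rewrite (negPf (supp0 _ _)).
have r_tr : transitive r.
  move=> g e f /and3P[eM gM /exists_inP[x Nx xeg]] /and3P[_ fM /exists_inP[y Ny ygf]].
  apply/and3P; split=> //; apply/exists_inP; exists (x * y); first exact: NM.
  by rewrite suppM //; apply/exists_inP; exists g; rewrite ?xeg.
have [s [s_irr s_tr s_tot rs]] := linear_extension r_irr r_tr.
(* The extension orders all of T; cutting it to the blocks keeps every pair of r, since supports do
   not leave a block. *)
exists [ffun i => [set p in setX (Mi i) (Mi i) | s p.1 p.2]].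
  move=> i; rewrite ffunE; split=> [|e|e f g|e f ei fi nef].
  - by apply/subsetP => p; rewrite inE => /andP[].
  - by rewrite inE /= s_irr andbF.
  - rewrite !inE /= => /andP[/andP[-> _]] /s_tr sef /andP[/andP[_ ->]] /sef -> //.
  - by rewrite !inE /= ei fi s_tot.
apply/subsetP => x Nx; apply/semigroup_of_ordersP => e f eM fM xef.
have [i ei] := Mi_cover eM; exists i.
rewrite ffunE !inE /= ei (supp_Mi eM fM xef ei) rs //=.
by rewrite eM fM; apply/exists_inP; exists x.
Qed.

(** Every nilpotent subsemigroup lies in one given by linear orders, and those are pairwise
    incomparable. *)
Lemma maximal_nilpotentP N : maximal_nilpotent_subsemigroup N <->
  exists2 rho, linear_orders rho & N = semigroup_of_orders rho.
Proof.
split=> [[nilN maxN]|[rho lin ->]].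
  have [rho lin sub] := nilpotent_sub_semigroup_of_orders nilN.
  by exists rho => //; rewrite (maxN _ (semigroup_of_orders_nilpotent lin)).
split; first exact: semigroup_of_orders_nilpotent.
move=> N' nilN' sub.
have [rho' lin' sub'] := nilpotent_sub_semigroup_of_orders nilN'.
have eqrho := semigroup_of_orders_sub lin lin' (subset_trans sub sub').
by apply/eqP; rewrite eqEsubset sub {1}eqrho sub'.
Qed.

Lemma orders_of_semigroup_bij : set_bij
  [set N | maximal_nilpotent_subsemigroup N]%classic
  [set rho | linear_orders rho]%classic orders_of_semigroup.
Proof.
split=> [N|N N'|rho lin] /=.
- by case/maximal_nilpotentP=> rho lin ->; rewrite semigroup_of_ordersK.
- move=> /set_mem/maximal_nilpotentP[rho lin ->].
  move=> /set_mem/maximal_nilpotentP[rho' lin' ->].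
  by rewrite !semigroup_of_ordersK // => ->.
- exists (semigroup_of_orders rho); last exact: semigroup_of_ordersK.
  by apply/maximal_nilpotentP; exists rho.
Qed.

End OrdersAndNilpotency.

(** * Passage to the Rees quotient by the radical *)

Lemma rees_projM (S : finSemigroup0Type) (I : ideal S) (x y : S) :
  rees_proj I (x * y) = rees_proj I x * rees_proj I y.
Proof.
apply: val_inj; rewrite /= /rees_repr.
have [xI|_] := boolP (x \in I); first by rewrite mul0s ideal0 idealMr.
by have [yI|_] := boolP (y \in I); rewrite // muls0 ideal0 idealMl.
Qed.

Lemma rees_proj_val (S : finSemigroup0Type) (I : ideal S) (q : rees_quotient I) :
  rees_proj I (val q) = q.
Proof.
apply: val_inj; rewrite /= /rees_repr; case: q => x /= /orP[/eqP ->|/negPf ->] //.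
by case: ifP.
Qed.

Lemma rees_proj_eq0 (S : finSemigroup0Type) (I : ideal S) (x : S) :
  rees_proj I x = 0 -> x \in I.
Proof.
move/(congr1 val); rewrite /= /rees_repr ideal0.
by case: ifPn => // xI x0; rewrite x0 ideal0 in xI.
Qed.

Lemma radical_nil (S : finSemigroup0Type) (x : S) :
  x \in radical S -> exists n, spow x n = 0.
Proof.
case/radicalP=> n Rn; exists n; apply/set1P; rewrite -Rn.
exact: set_expS_spow (principal_ideal_refl x).
Qed.

Theorem theorem5p8 (S : finSemigroup0Type)
    (M : {set rees_quotient (radical S)})
    (M_neq0 : M != set0)
    (M_min : forall e, e \in M -> minimal_idempotent e)
    (M_comm : forall e f, e \in M -> f \in M -> e * f = f * e)
    (M_sep : forall x : rees_quotient (radical S), x != 0 ->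
       exists e f, [/\ e \in M, f \in M & e * x * f != 0])
    (M_mid : forall x y e f : rees_quotient (radical S), e \in M -> f \in M ->
       [set e * x * g * y * f | g in M] \subset [set 0; e * x * y * f] /\
       (e * x * y * f != 0 -> [set e * x * g * y * f | g in M] != [set 0]))
    (k : nat) (Mi : 'I_k -> {set rees_quotient (radical S)})
    (Mi_inj : injective Mi)
    (Mi_classes : [set Mi i | i : 'I_k] =
                  equivalence_partition (fun e f => greenD e f) M) :
  exists Phi : {set S} ->
      {ffun 'I_k -> {set rees_quotient (radical S) * rees_quotient (radical S)}},
    set_bij
      [set N | maximal_nilpotent_subsemigroup N]%classic
      [set rho : {ffun 'I_k -> {set rees_quotient (radical S) * rees_quotient (radical S)}} |
         forall i : 'I_k, strict_linear_order (Mi i) (rho i)]%classic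
      Phi.
Proof.
have Midem e : e \in M -> e * e = e by case/M_min.
have Mn0 e : e \in M -> e != 0 by move/M_min/minimal_idempotent_neq0.
have MD e f : e \in M -> f \in M -> greenD e f -> exists d, e * d * f != 0.
  by move=> eM fM; apply: greenD_neq0; auto.
have DM e f x : e \in M -> f \in M -> e * x * f != 0 -> greenD f e.
  by move=> eM fM; apply: neq0_greenD; auto.
(* Being defined as L followed by R, D is not visibly symmetric. On M it amounts to a non-zero e d
   f, and such a product gives D with the sides exchanged; transitivity below comes from multiplying
   two such products. *)
have Dsym e f : e \in M -> f \in M -> greenD e f -> greenD f e.
  by move=> eM fM /(MD e f eM fM)[d /(DM e f d eM fM)].
pose supp (x : S) e f := e * rees_proj (radical S) x * f != 0.
have mul_neq0 x y e f g : e \in M -> f \in M -> g \in M ->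
    e * x * g != 0 -> g * y * f != 0 -> e * x * g * y * f != 0.
  move=> eM fM gM exg gyf; rewrite -(mulgA _ y f).
  by apply: minimal_idempotent_mul (M_min g gM) exg _; rewrite mulgA.
have Dtrans e f g : e \in M -> f \in M -> g \in M ->
    greenD e f -> greenD f g -> greenD e g.
  move=> eM fM gM /(MD e f eM fM)[x ef] /(MD f g fM gM)[y fg].
  by apply: Dsym => //; apply: (DM e g (x * f * y)) => //; rewrite !mulgA mul_neq0.
have MiE i : exists2 e, e \in M & Mi i = [set f in M | greenD e f].
  apply/imsetP; have : Mi i \in [set Mi j | j : 'I_k] by apply: imset_f.
  by rewrite Mi_classes.
exists (orders_of_semigroup supp Mi).
apply: (@orders_of_semigroup_bij S _ M).
- by move=> i e; have [f _ ->] := MiE i; rewrite inE => /andP[].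
- move=> e eM.
  have : [set f in M | greenD e f] \in [set Mi i | i : 'I_k].
    by rewrite Mi_classes; apply/imsetP; exists e.
  by case/imsetP=> i _ ie; exists i; rewrite -ie inE eM greenD_refl.
- move=> i j e; have [f fM Ei] := MiE i; have [g gM Ej] := MiE j.
  rewrite Ei Ej !inE => /andP[eM fe] /andP[_ ge]; apply: Mi_inj.
  have eg := Dsym _ _ gM eM ge; have ef := Dsym _ _ fM eM fe.
  rewrite Ei Ej; apply/setP => h; rewrite !inE; have [hM|//] := boolP (h \in M).
  apply/idP/idP => [fh|gh].
    by apply: (Dtrans g e h) => //; apply: (Dtrans e f h).
  by apply: (Dtrans f e h) => //; apply: (Dtrans e g h).
- move=> x e f i eM fM xef; have [g gM ->] := MiE i.
  rewrite !inE eM fM /= => ge; apply: (Dtrans g e f) => //.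
  by apply: Dsym => //; apply: DM xef.
- move=> e f; rewrite /supp negbK; apply/eqP.
  have -> : rees_proj (radical S) 0 = 0 by [].
  by rewrite muls0 mul0s.
- move=> x y e f eM fM; rewrite /supp rees_projM mulgA.
  have [/subsetP sub nz] := M_mid (rees_proj _ x) (rees_proj _ y) e f eM fM.
  have val_g g : g \in M -> e * rees_proj _ x * g * rees_proj _ y * f != 0 ->
      e * rees_proj _ x * g * rees_proj _ y * f = e * rees_proj _ x * rees_proj _ y * f.
    move=> gM gn0; have := sub _ (imset_f (fun g => e * _ * g * _ * f) gM).
    by rewrite !inE (negPf gn0) => /eqP.
  apply/idP/exists_inP => [/nz|[g gM /andP[exg gyf]]]; last first.
    by have gn0 := mul_neq0 _ _ _ _ _ eM fM gM exg gyf; rewrite -(val_g g).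
  (* If no g links e to f, every product e x g y f is 0. As M is non-empty, the set of these
     products is then exactly {0}, which [setn0] excludes. *)
  move=> setn0; apply/exists_inP; apply: contraNT setn0.
  rewrite negb_exists_in => /forall_inP allg.
  have all0 g : g \in M -> e * rees_proj _ x * g * rees_proj _ y * f = 0.
    move=> gM; have := allg g gM; rewrite negb_and !negbK => /orP[]/eqP g0.
      by rewrite g0 !mul0s.
    by rewrite -!(mulgA _ _ f) -(mulgA _ g) (mulgA g) g0 muls0.
  have /set0Pn[g gM] := M_neq0; apply/eqP/setP => z; rewrite inE.
  apply/imsetP/eqP => [[h hM ->]|->]; first exact: all0.
  by exists g; rewrite ?all0.
- move=> i e f ei fi; have [g gM Ei] := MiE i.
  move: ei fi; rewrite Ei !inE => /andP[eM ge] /andP[fM gf].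
  have [|d edf] := MD e f eM fM; first by apply: (Dtrans e g f) => //; apply: Dsym.
  (* Orthogonality of distinct elements of M kills e' (e d f) f' unless e' = e and f' = f. *)
  exists (val (e * d * f)) => e' f' e'M f'M; rewrite /supp rees_proj_val.
  have [->|ne] := eqVneq e' e; last first.
    rewrite !mulgA (minimal_idempotent_commute (M_min _ e'M) (M_min _ eM)) //.
      by rewrite !mul0s eqxx.
    exact: M_comm.
  have [->|nf] := eqVneq f' f; first by rewrite !mulgA Midem // -(mulgA _ f f) Midem.
  rewrite !mulgA -(mulgA _ f f')
    (minimal_idempotent_commute (M_min _ fM) (M_min _ f'M)) //.
  + by rewrite muls0 eqxx.
  + exact: M_comm.
  + by rewrite eq_sym.
(* By (2) an empty support means that the image of x is 0, so x lies in the radical. *)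
- move=> x xnil; apply: radical_nil; apply: rees_proj_eq0; apply/eqP.
  apply/negPn/negP => /M_sep[e [f [eM fM xef]]].
  by move/negP: (xnil e f eM fM); apply.
Qed.
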